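(* Let $n\ge2$. There is an algebra map $\Phi_{q,n}^{\mathbf D}:U_q(\mathfrak{so}_{2n})\to Cl_q(n)$ satisfying $\Phi_{q,n}^{\mathbf D}(X)=\Phi_{q,n}(X)$ for $X$ in the subalgebra $U_q(\mathfrak{sl}_n)\subset U_q(\mathfrak{so}_{2n})$ generated by $E_i,F_i,K_i^{\pm1}$ ($1\le i\le n-1$), and $$\Phi_{q,n}^{\mathbf D}(E_n)=\psi_{n-1}^\dagger\psi_n^\dagger,\qquad \Phi_{q,n}^{\mathbf D}(F_n)=\psi_n\psi_{n-1},\qquad \Phi_{q,n}^{\mathbf D}(K_n)=(q\,\omega_{n-1}\omega_n)^{-1}.$$
   Context: The base field is $\mathbb C(q)$, $q$ an indeterminate. $Cl_q(n)$ is the unital associative algebra generated by $\psi_a,\psi_a^\dagger,\omega_a^{\pm1}$ ($1\le a\le n$) with relations: the $\omega_a$ commute; $\omega_a\psi_b\omega_a^{-1}=q^{\delta_{ab}}\psi_b$; $\omega_a\psi_b^\dagger\omega_a^{-1}=q^{-\delta_{ab}}\psi_b^\dagger$; $\psi_a\psi_b+\psi_b\psi_a=0=\psi_a^\dagger\psi_b^\dagger+\psi_b^\dagger\psi_a^\dagger$; $\psi_a\psi_b^\dagger+\psi_b^\dagger\psi_a=0$ for $a\ne b$; $\psi_a\psi_a^\dagger=\frac{q\omega_a-q^{-1}\omega_a^{-1}}{q-q^{-1}}$, $\psi_a^\dagger\psi_a=-\frac{\omega_a-\omega_a^{-1}}{q-q^{-1}}$. $U_q(\mathfrak{so}_{2n})$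 has generators $E_i,F_i,K_i^{\pm1}$ ($1\le i\le n$) and relations: the $K_i$ commute, $K_iE_jK_i^{-1}=q^{a_{ij}}E_j$, $K_iF_jK_i^{-1}=q^{-a_{ij}}F_j$, $[E_i,F_j]=\delta_{ij}\frac{K_i-K_i^{-1}}{q-q^{-1}}$, and the quantum Serre relations, where $(a_{ij})$ is the Cartan matrix of type $D_n$ with simple roots $\alpha_i=e_i-e_{i+1}$ ($i<n$), $\alpha_n=e_{n-1}+e_n$. The algebra map $\Phi_{q,n}:U_q(\mathfrak{sl}_n)\to Cl_q(n)$ is $E_i\mapsto\psi_i^\dagger\psi_{i+1}$, $F_i\mapsto\psi_{i+1}^\dagger\psi_i$, $K_i\mapsto\omega_i^{-1}\omega_{i+1}$ for $1\le i\le n-1$. *)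

(* Defs.v *)
From HB Require Import structures.
From mathcomp Require Import all_boot all_order all_algebra.
From mathcomp Require Import ring_quotient generic_quotient.
From mathcomp Require Import finmap boolp reals complex monalg.

Set Implicit Arguments.
Unset Strict Implicit.
Unset Printing Implicit Defensive.

Import GRing.Theory.
Local Open Scope ring_scope.

Lemma bilinear_ext (I J : Type) (A B : zmodType) (g : I -> J -> A)
    (f f' : A -> A -> B) :
  (forall P : A -> Prop, P 0 -> (forall i j x, P x -> P (g i j + x)) ->
    forall x, P x) ->
  (forall x y z, f (x + y) z = f x z + f y z) ->
  (forall x y z, f x (y + z) = f x y + f x z) ->
  (forall x y z, f' (x + y) z = f' x z + f' y z) ->
  (forall x y z, f' x (y + z) = f' x y + f' x z) ->
  (forall i j k l, f (g i j) (g k l) = f' (g i j) (g k l)) ->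
  forall x y, f x y = f' x y.
Proof.
move=> indA fDl fDr f'Dl f'Dr ff'.
have z0 (h : A -> B) : {morph h : x y / x + y} -> h 0 = 0.
  by move=> hD; apply: (addrI (h 0)); rewrite -hD !addr0.
elim/indA => [|i j x IH] y.
  rewrite (z0 (f^~ y)) ?(z0 (f'^~ y)) //.
rewrite fDl f'Dl IH; congr (_ + _).
elim/indA: y => [|k l y IHy]; first by rewrite (z0 (f _)) ?(z0 (f' _)).
by rewrite fDr f'Dr IHy ff'.
Qed.

Section FreeAlgebra.
Variables (F : fieldType) (X : choiceType).

Definition freeAlg := {malg F[{fmonom X}]}.
HB.instance Definition _ := GRing.Lalgebra.on freeAlg.

Definition fmono (c : F) (m : {fmonom X}) : freeAlg := << c *g m >>.

Lemma fmonoZ c d m : c *: fmono d m = fmono (c * d) m.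
Proof.
apply/malgP => k; apply: etrans (mcoeffZ c << d *g m >> k) _.
by rewrite !mcoeffU mulrnAr.
Qed.

Lemma fmonoM c d k m : fmono c k * fmono d m = fmono (c * d) (mmul k m).
Proof. exact: fgmulUU. Qed.

Lemma fmonoE (x : freeAlg) : x = \sum_(m <- msupp x) fmono x@_m m.
Proof. exact: monalgE. Qed.

Lemma freeAlg_ind (P : freeAlg -> Prop) :
  P 0 -> (forall c m x, P x -> P (fmono c m + x)) -> forall x, P x.
Proof.
move=> P0 PD x; rewrite [x]fmonoE.
by elim: (msupp x : seq _) => [|m s IH]; rewrite (big_nil, big_cons); auto.
Qed.

Lemma freeAlg_scalerAr (c : F) (x y : freeAlg) : c *: (x * y) = x * (c *: y).
Proof.
apply: (bilinear_ext (f := fun x y => c *: (x * y))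
  (f' := fun x y => x * (c *: y)) freeAlg_ind) => {x y}.
- by move=> x y z; rewrite [_ * z]mulrDl [LHS]scalerDr.
- by move=> x y z; rewrite [x * _]mulrDr [LHS]scalerDr.
- by move=> x y z; rewrite [LHS]mulrDl.
- by move=> x y z; rewrite (scalerDr c y z) [LHS]mulrDr.
by move=> d k e m; rewrite fmonoM !fmonoZ fmonoM mulrCA.
Qed.

HB.instance Definition _ := GRing.Lalgebra_isAlgebra.Build F freeAlg
  freeAlg_scalerAr.

End FreeAlgebra.

HB.lock Definition fgen (F : fieldType) (X : choiceType) (x : X) : freeAlg F X :=
  fmono 1 (fmu x).

Arguments fgen F {X} x.

(* The F-algebra presented by A together with the relations l = r for rel l r *)
(* is the quotient of A by the two-sided ideal generated by all these l - r.  *)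
(* Such a quotient may be the zero ring, so it is not an algType (these are   *)
(* nontrivial by definition) but a pzRingType and an lmodType whose scaling  *)
(* satisfies both algebra laws, presAl and presAr.                            *)
Section Presentation.
Variables (F : fieldType) (A : algType F) (rel : A -> A -> Prop).

Inductive ideal_gen : A -> Prop :=
| Ideal0 : ideal_gen 0
| IdealD a l r b x :
    rel l r -> ideal_gen x -> ideal_gen (a * (l - r) * b + x).

Lemma ideal_genD x y : ideal_gen x -> ideal_gen y -> ideal_gen (x + y).
Proof.
elim=> [|a l r b {}x lr _ IH] Iy; first by rewrite add0r.
by rewrite -addrA; apply: IdealD => //; apply: IH.
Qed.

Lemma ideal_genM a b x : ideal_gen x -> ideal_gen (a * x * b).
Proof.
elim=> [|c l r d {}x lr _ IH]; first by rewrite mulr0 mul0r; exact: Ideal0.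
by rewrite mulrDr mulrDl !mulrA -(mulrA (a * c * _)); apply: IdealD.
Qed.

Definition ideal_pred : {pred A} := fun x => `[< ideal_gen x >].

Lemma ideal_zmod_closed : zmod_closed ideal_pred.
Proof.
split=> [|x y /asboolP Ix /asboolP Iy]; apply/asboolP; first exact: Ideal0.
apply: ideal_genD => //.
by rewrite -mulN1r -[_ * y]mulr1; exact: ideal_genM.
Qed.

HB.instance Definition _ := GRing.isZmodClosed.Build A ideal_pred
  ideal_zmod_closed.

Definition presAlg := Quotient.quot ideal_pred.
HB.instance Definition _ := GRing.Zmodule.on presAlg.

Definition pproj (x : A) : presAlg := \pi_presAlg%qT x.
Definition prepr (x : presAlg) : A := repr x.

Lemma preprK : cancel prepr pproj. Proof. exact: reprK. Qed.

Lemma pproj_eq x y : pproj x = pproj y <-> ideal_gen (x - y).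
Proof.
split=> [/eqP|Ixy].
  by rewrite /pproj -[_ == _]Quotient.idealrBE => /asboolP.
by apply/eqP; rewrite /pproj -[_ == _]Quotient.idealrBE; apply/asboolP.
Qed.

Lemma pprojB : zmod_morphism pproj.
Proof. by move=> x y; rewrite /pproj /presAlg !piE. Qed.

HB.instance Definition _ := GRing.isZmodMorphism.Build A presAlg pproj pprojB.

Lemma prepr_proj x : ideal_gen (prepr (pproj x) - x).
Proof. by apply/pproj_eq; rewrite preprK. Qed.

Definition pone : presAlg := pproj 1.
Definition pmul_def (x y : presAlg) : presAlg := pproj (prepr x * prepr y).
Definition pscale_def (c : F) (x : presAlg) : presAlg := pproj (c *: prepr x).

(* Locked, as unification would otherwise unfold products down to freeAlg.   *)
Fact presAlg_key : unit. Proof. by []. Qed.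
Definition pmul := locked_with presAlg_key pmul_def.
Definition pscale := locked_with presAlg_key pscale_def.
Canonical pmul_unlockable := [unlockable fun pmul].
Canonical pscale_unlockable := [unlockable fun pscale].

Lemma pproj_pmul x y : pproj (x * y) = pmul (pproj x) (pproj y).
Proof.
rewrite unlock; apply/esym/pproj_eq; set x' := prepr _; set y' := prepr _.
have -> : x' * y' - x * y = 1 * (x' - x) * y' + x * (y' - y) * 1.
  by rewrite mul1r mulr1 mulrBl mulrBr addrA subrK.
by apply: ideal_genD; apply: ideal_genM; apply: prepr_proj.
Qed.

Lemma pproj_pscale c x : pproj (c *: x) = pscale c (pproj x).
Proof.
rewrite unlock; apply/esym/pproj_eq; rewrite -scalerBr -mulr_algl -[_ * _]mulr1.
by apply: ideal_genM; apply: prepr_proj.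
Qed.

Lemma pmulA : associative pmul.
Proof.
move=> x y z; rewrite -[x]preprK -[y]preprK -[z]preprK.
by rewrite -!pproj_pmul mulrA.
Qed.

Lemma pmul1r : left_id pone pmul.
Proof. by move=> x; rewrite -[x]preprK -pproj_pmul mul1r. Qed.

Lemma pmulr1 : right_id pone pmul.
Proof. by move=> x; rewrite -[x]preprK -pproj_pmul mulr1. Qed.

Lemma pmulDl : left_distributive pmul +%R.
Proof.
move=> x y z; rewrite -[x]preprK -[y]preprK -[z]preprK.
by rewrite -raddfD -!pproj_pmul mulrDl raddfD.
Qed.

Lemma pmulDr : right_distributive pmul +%R.
Proof.
move=> x y z; rewrite -[x]preprK -[y]preprK -[z]preprK.
by rewrite -raddfD -!pproj_pmul mulrDr raddfD.
Qed.

HB.instance Definition _ := GRing.Zmodule_isPzRing.Build presAlg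
  pmulA pmul1r pmulr1 pmulDl pmulDr.

Lemma pscaleA a b x : pscale a (pscale b x) = pscale (a * b) x.
Proof. by rewrite -[x]preprK -!pproj_pscale scalerA. Qed.

Lemma pscale1 : left_id 1 pscale.
Proof. by move=> x; rewrite -[x]preprK -pproj_pscale scale1r. Qed.

Lemma pscaleDr : right_distributive pscale +%R.
Proof.
move=> a x y; rewrite -[x]preprK -[y]preprK.
by rewrite -raddfD -!pproj_pscale scalerDr raddfD.
Qed.

Lemma pscaleDl x : {morph pscale^~ x : a b / a + b}.
Proof.
by move=> a b; rewrite -[x]preprK -!pproj_pscale scalerDl raddfD.
Qed.

HB.instance Definition _ := GRing.Zmodule_isLmodule.Build F presAlg
  pscaleA pscale1 pscaleDr pscaleDl.

Lemma pproj_monoid : monoid_morphism pproj.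
Proof. by split; last exact: pproj_pmul. Qed.

HB.instance Definition _ := GRing.isMonoidMorphism.Build A presAlg pproj
  pproj_monoid.

Lemma pproj_scale : scalable pproj.
Proof. by move=> c x; rewrite pproj_pscale. Qed.

HB.instance Definition _ := GRing.isScalable.Build F A presAlg *:%R pproj
  pproj_scale.

Lemma pproj0 : pproj 0 = 0. Proof. exact: raddf0. Qed.
Lemma pproj1 : pproj 1 = 1. Proof. by []. Qed.
Lemma pprojD x y : pproj (x + y) = pproj x + pproj y.
Proof. exact: raddfD. Qed.
Lemma pprojN x : pproj (- x) = - pproj x. Proof. exact: raddfN. Qed.
Lemma pprojM x y : pproj (x * y) = pproj x * pproj y.
Proof. exact: pproj_pmul. Qed.
Lemma pprojZ c x : pproj (c *: x) = c *: pproj x.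
Proof. exact: pproj_pscale. Qed.
Definition pprojE := (pproj0, pproj1, pprojD, pprojN, pprojM, pprojZ).

Lemma pproj_rel l r : rel l r -> pproj l = pproj r.
Proof.
move=> lr; apply/pproj_eq; rewrite -[_ - _]addr0 -[_ - _]mul1r.
by rewrite -[1 * _]mulr1; apply: IdealD => //; exact: Ideal0.
Qed.

Lemma presAl (c : F) (x y : presAlg) : c *: (x * y) = (c *: x) * y.
Proof.
rewrite -[x]preprK -[y]preprK -rmorphM -!linearZ -rmorphM /=.
by rewrite scalerAl.
Qed.

Lemma presAr (c : F) (x y : presAlg) : c *: (x * y) = x * (c *: y).
Proof.
rewrite -[x]preprK -[y]preprK -rmorphM -!linearZ -rmorphM /=.
by rewrite scalerAr.
Qed.

End Presentation.

Section Morphism.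
Variables (F : fieldType) (A B : algType F).
Variables (relA : A -> A -> Prop) (relB : B -> B -> Prop).

Definition alg_morphism (phi : presAlg relA -> presAlg relB) : Prop :=
  linear phi /\ monoid_morphism phi.

End Morphism.


HB.lock Definition pgen (F : fieldType) (X : choiceType)
    (rel : freeAlg F X -> freeAlg F X -> Prop) (x : X) : presAlg rel :=
  pproj rel (fgen F x).

Lemma pproj_gen (F : fieldType) (X : choiceType)
  (rel : freeAlg F X -> freeAlg F X -> Prop) (x : X) :
  pproj rel (fgen F x) = pgen rel x.
Proof. by rewrite pgen.unlock. Qed.

Section Lift.
Variables (F : fieldType) (X : choiceType) (B : algType F).
Variables (rel : freeAlg F X -> freeAlg F X -> Prop) (relB : B -> B -> Prop).
Local Notation Q := (presAlg relB).
Local Notation P := (presAlg rel).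

Variable f : X -> Q.

(* The algebra morphism on the free algebra extending f. *)
Definition feval (x : freeAlg F X) : Q :=
  \sum_(m <- msupp x) x@_m *: \prod_(i <- (m : seq X)) f i.

Lemma fevalEw (d : {fset {fmonom X}}) (x : freeAlg F X) :
  (msupp x `<=` d)%fset ->
  feval x = \sum_(m <- d) x@_m *: \prod_(i <- (m : seq X)) f i.
Proof.
move=> le; rewrite /feval (big_fset_incl _ le) => //= m _ /mcoeff_outdom ->.
by rewrite scale0r.
Qed.

Lemma feval_linear : linear feval.
Proof.
move=> c x y; pose d := (msupp x `|` msupp y)%fset.
rewrite (@fevalEw d x) ?fsubsetUl // (@fevalEw d y) ?fsubsetUr //.
rewrite (@fevalEw d).
  rewrite scaler_sumr -big_split /=; apply: eq_bigr => m _.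
  by rewrite mcoeffD mcoeffZ scalerDl scalerA.
apply: (fsubset_trans (msuppD_le _ _)); apply: fsetSU; exact: msuppZ_le.
Qed.

HB.instance Definition _ := GRing.isLinear.Build F (freeAlg F X) Q *:%R feval
  feval_linear.

Lemma feval_mono c m : feval (fmono c m) = c *: \prod_(i <- (m : seq X)) f i.
Proof. by rewrite (fevalEw msuppU_le) big_seq_fset1 mcoeffUU. Qed.

Lemma feval_monoid : monoid_morphism feval.
Proof.
split=> [|x y]; first by rewrite [LHS]feval_mono fm1 big_nil scale1r.
have fD := raddfD feval.
apply: (bilinear_ext (f := fun x y => feval (x * y))
  (f' := fun x y => feval x * feval y) (@freeAlg_ind F X)) => {x y}.
- by move=> x y z; rewrite [_ * z]mulrDl [LHS]fD.
- by move=> x y z; rewrite [x * _]mulrDr [LHS]fD.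
- by move=> x y z; rewrite [in LHS]fD [LHS]mulrDl.
- by move=> x y z; rewrite [in LHS]fD [LHS]mulrDr.
move=> c k d m.
by rewrite fmonoM !feval_mono fmM big_cat /= -presAl -presAr scalerA.
Qed.

HB.instance Definition _ := GRing.isMonoidMorphism.Build (freeAlg F X) Q feval
  feval_monoid.

Lemma feval0 : feval 0 = 0. Proof. exact: raddf0. Qed.
Lemma feval1 : feval 1 = 1. Proof. exact: feval_monoid.1. Qed.
Lemma fevalD x y : feval (x + y) = feval x + feval y.
Proof. exact: raddfD. Qed.
Lemma fevalN x : feval (- x) = - feval x. Proof. exact: raddfN. Qed.
Lemma fevalM x y : feval (x * y) = feval x * feval y.
Proof. exact: feval_monoid.2. Qed.
Lemma fevalZ c x : feval (c *: x) = c *: feval x.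
Proof. exact: linearZ. Qed.

Lemma feval_gen x : feval (fgen F x) = f x.
Proof. by rewrite fgen.unlock feval_mono fmU big_seq1 scale1r. Qed.

Definition fevalE := (feval0, feval1, fevalD, fevalN, fevalM, fevalZ, feval_gen).

(* The map sending each generator x to f x. It is well defined, and then the *)
(* unique algebra morphism doing so, when f respects the relations.          *)
Definition plift (x : P) : Q := feval (prepr x).

Hypothesis frel : forall l r, rel l r -> feval l = feval r.

Lemma plift_proj x : plift (pproj rel x) = feval x.
Proof.
apply/eqP; rewrite -subr_eq0 -raddfB; apply/eqP.
elim: (prepr_proj rel x) => [|a l r b y lr _ IH]; first by rewrite raddf0.
by rewrite raddfD /= IH !rmorphM /= raddfB /= (frel lr) subrr mulr0 mul0r add0r.
Qed.

Lemma plift_morphism : alg_morphism plift.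
Proof.
split=> [c x y|]; last split=> [|x y].
- rewrite -[x]preprK -[y]preprK -linearP /= !plift_proj; exact: linearP.
- by rewrite -[1](rmorph1 (pproj rel)) plift_proj rmorph1.
rewrite -[x]preprK -[y]preprK -rmorphM /= !plift_proj; exact: rmorphM.
Qed.

Lemma plift_gen x : plift (pgen rel x) = f x.
Proof. by rewrite pgen.unlock plift_proj feval_gen. Qed.

End Lift.

Inductive clgen (n : nat) :=
| Psi of 'I_n | PsiD of 'I_n | Om of 'I_n | OmV of 'I_n.

Section ClGenChoice.
Variable n : nat.
Definition clgen_code (g : clgen n) : bool * bool * 'I_n :=
  match g with
  | Psi a => (true, true, a) | PsiD a => (true, false, a)
  | Om a => (false, true, a) | OmV a => (false, false, a)
  end.
Definition clgen_decode (c : bool * bool * 'I_n) : clgen n :=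
  match c with
  | (true, true, a) => Psi a | (true, false, a) => PsiD a
  | (false, true, a) => Om a | (false, false, a) => OmV a
  end.
Lemma clgen_codeK : cancel clgen_code clgen_decode. Proof. by case. Qed.
HB.instance Definition _ := Choice.copy (clgen n) (can_type clgen_codeK).
End ClGenChoice.

(* The q-deformed Clifford algebra Cl_q(n): psi_a, psi_a^dagger, omega_a and  *)
(* omega_a^{-1} are the classes of Psi a, PsiD a, Om a and OmV a.             *)
Section Clifford.
Variables (F : fieldType) (q : F) (n : nat).

Local Notation psi a := (fgen F (Psi a)).
Local Notation psiD a := (fgen F (PsiD a)).
Local Notation om a := (fgen F (Om a)).
Local Notation omV a := (fgen F (OmV a)).

Inductive cl_rel : freeAlg F (clgen n) -> freeAlg F (clgen n) -> Prop :=
| cl_omK a : cl_rel (om a * omV a) 1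
| cl_omVK a : cl_rel (omV a * om a) 1
| cl_omC a b : cl_rel (om a * om b) (om b * om a)
| cl_om_psi a b : cl_rel (om a * psi b * omV a) (q ^+ (a == b) *: psi b)
| cl_om_psiD a b : cl_rel (om a * psiD b * omV a) (q ^- (a == b) *: psiD b)
| cl_psi_psi a b : cl_rel (psi a * psi b + psi b * psi a) 0
| cl_psiD_psiD a b : cl_rel (psiD a * psiD b + psiD b * psiD a) 0
| cl_psi_psiD a b : a != b -> cl_rel (psi a * psiD b + psiD b * psi a) 0
| cl_psi_psiDK a : cl_rel (psi a * psiD a)
    ((q - q^-1)^-1 *: (q *: om a - q^-1 *: omV a))
| cl_psiD_psiK a : cl_rel (psiD a * psi a)
    (- ((q - q^-1)^-1 *: (om a - omV a))).

Local Notation Clq := (presAlg cl_rel).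

Definition cl_psi (a : 'I_n) : Clq := pgen cl_rel (Psi a).
Definition cl_psiD (a : 'I_n) : Clq := pgen cl_rel (PsiD a).
Definition cl_om (a : 'I_n) : Clq := pgen cl_rel (Om a).
Definition cl_omV (a : 'I_n) : Clq := pgen cl_rel (OmV a).

End Clifford.

Notation Clq q n := (presAlg (@cl_rel _ q n)).

Inductive uqgen (r : nat) :=
| GenE of 'I_r | GenF of 'I_r | GenK of 'I_r | GenKV of 'I_r.

Section UqGenChoice.
Variable r : nat.
Definition uqgen_code (g : uqgen r) : bool * bool * 'I_r :=
  match g with
  | GenE i => (true, true, i) | GenF i => (true, false, i)
  | GenK i => (false, true, i) | GenKV i => (false, false, i)
  end.
Definition uqgen_decode (c : bool * bool * 'I_r) : uqgen r :=
  match c with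
  | (true, true, i) => GenE i | (true, false, i) => GenF i
  | (false, true, i) => GenK i | (false, false, i) => GenKV i
  end.
Lemma uqgen_codeK : cancel uqgen_code uqgen_decode. Proof. by case. Qed.
HB.instance Definition _ := Choice.copy (uqgen r) (can_type uqgen_codeK).
End UqGenChoice.

Section QuantumGroup.
Variables (F : fieldType) (q : F).

Definition qint (m : nat) : F := (q ^+ m - q ^- m) / (q - q^-1).
Definition qfact (m : nat) : F := \prod_(1 <= k < m.+1) qint k.
Definition qbinom (m k : nat) : F := qfact m / (qfact k * qfact (m - k)).

(* The quantum enveloping algebra of a simply laced Cartan matrix A (so that  *)
(* q_i = q for all i); K_i^{-1} is the class of GenKV i.                      *)
Variables (r : nat) (A : 'I_r -> 'I_r -> int).

Local Notation genE i := (fgen F (GenE i)).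
Local Notation genF i := (fgen F (GenF i)).
Local Notation genK i := (fgen F (GenK i)).
Local Notation genKV i := (fgen F (GenKV i)).

Definition qserre (m : nat) (x y : freeAlg F (uqgen r)) : freeAlg F (uqgen r) :=
  \sum_(0 <= k < m.+1)
    ((-1) ^+ k * qbinom m k) *: (x ^+ (m - k) * y * x ^+ k).

Inductive uq_rel : freeAlg F (uqgen r) -> freeAlg F (uqgen r) -> Prop :=
| uq_KK i : uq_rel (genK i * genKV i) 1
| uq_KVK i : uq_rel (genKV i * genK i) 1
| uq_KC i j : uq_rel (genK i * genK j) (genK j * genK i)
| uq_KE i j : uq_rel (genK i * genE j * genKV i) (q ^ A i j *: genE j)
| uq_KF i j : uq_rel (genK i * genF j * genKV i) (q ^ (- A i j) *: genF j)
| uq_EF i j : uq_rel (genE i * genF j - genF j * genE i)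
    (((i == j)%:R / (q - q^-1)) *: (genK i - genKV i))
| uq_serreE i j : i != j -> uq_rel (qserre `|1 - A i j|%N (genE i) (genE j)) 0
| uq_serreF i j : i != j -> uq_rel (qserre `|1 - A i j|%N (genF i) (genF j)) 0.

Local Notation Uq := (presAlg uq_rel).

Definition uq_E (i : 'I_r) : Uq := pgen uq_rel (GenE i).
Definition uq_F (i : 'I_r) : Uq := pgen uq_rel (GenF i).
Definition uq_K (i : 'I_r) : Uq := pgen uq_rel (GenK i).
Definition uq_KV (i : 'I_r) : Uq := pgen uq_rel (GenKV i).

End QuantumGroup.

Notation Uq q A := (presAlg (uq_rel q A)).

(* Indices start at 0: the simple root alpha_i is rootA (i - 1), resp.        *)
(* rootD (i - 1), given by its coordinates in the orthonormal basis e_k.      *)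
(* In rootD, the case i.+1 = n is alpha_n = e_{n-1} + e_n.                    *)
Section Roots.
Variable n : nat.

Definition fst_ord (i : 'I_n.-1) : 'I_n := widen_ord (leq_pred n) i.

Lemma snd_ord_subproof (i : 'I_n.-1) : (i.+1 < n)%N.
Proof. by case: i => i /= lt_in; rewrite -ltn_predRL. Qed.

Definition snd_ord (i : 'I_n.-1) : 'I_n := Ordinal (snd_ord_subproof i).

Definition rootA (i : 'I_n.-1) (k : 'I_n) : int :=
  (k == fst_ord i)%:R - (k == snd_ord i)%:R.

Definition rootD (i k : 'I_n) : int :=
  if (i.+1 < n)%N then (k == i :> nat)%:R - (k == i.+1 :> nat)%:R
  else (k.+1 == i :> nat)%:R + (k == i :> nat)%:R.

(* All roots have squared length 2, so that the Cartan integer of alpha_i,    *)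
(* alpha_j is their inner product.                                            *)
Definition cartan (r : nat) (alpha : 'I_r -> 'I_n -> int) (i j : 'I_r) : int :=
  \sum_(k < n) alpha i k * alpha j k.

End Roots.

Section Maps.
Variables (F : fieldType) (q : F) (n : nat).

Local Notation Uq_sl := (Uq q (cartan (@rootA n))).
Local Notation Uq_so := (Uq q (cartan (@rootD n))).

Definition sl_so_gen (g : uqgen n.-1) : Uq_so :=
  match g with
  | GenE i => uq_E q _ (fst_ord i)
  | GenF i => uq_F q _ (fst_ord i)
  | GenK i => uq_K q _ (fst_ord i)
  | GenKV i => uq_KV q _ (fst_ord i)
  end.

(* The map U_q(sl_n) -> U_q(so_2n) sending E_i, F_i, K_i to E_i, F_i, K_i for *)
(* i < n; its image is the subalgebra generated by these elements. sl_so and  *)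
(* Phi are shown below to be algebra morphisms with the expected values.      *)
Definition sl_so : Uq_sl -> Uq_so := plift sl_so_gen.

Definition Phi_gen (g : uqgen n.-1) : Clq q n :=
  match g with
  | GenE i => cl_psiD q (fst_ord i) * cl_psi q (snd_ord i)
  | GenF i => cl_psiD q (snd_ord i) * cl_psi q (fst_ord i)
  | GenK i => cl_omV q (fst_ord i) * cl_om q (snd_ord i)
  | GenKV i => cl_om q (fst_ord i) * cl_omV q (snd_ord i)
  end.

Definition Phi : Uq_sl -> Clq q n := plift Phi_gen.

End Maps.

Notation Uq_sl q n := (Uq q (cartan (@rootA n))).
Notation Uq_so q n := (Uq q (cartan (@rootD n))).


Section UqRelations.
Variables (F : fieldType) (q : F) (r : nat) (A : 'I_r -> 'I_r -> int).

Local Notation e := (uq_E q A).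
Local Notation f := (uq_F q A).
Local Notation t := (uq_K q A).
Local Notation tV := (uq_KV q A).

Lemma uqKK i : t i * tV i = 1.
Proof. rewrite /uq_E /uq_F /uq_K /uq_KV -!pproj_gen -!pprojM; apply: pproj_rel; exact: uq_KK. Qed.
Lemma uqKVK i : tV i * t i = 1.
Proof. rewrite /uq_E /uq_F /uq_K /uq_KV -!pproj_gen -!pprojM; apply: pproj_rel; exact: uq_KVK. Qed.
Lemma uqKC i j : t i * t j = t j * t i.
Proof. rewrite /uq_E /uq_F /uq_K /uq_KV -!pproj_gen -!pprojM; apply: pproj_rel; exact: uq_KC. Qed.
Lemma uqKE i j : t i * e j * tV i = q ^ A i j *: e j.
Proof. rewrite /uq_E /uq_F /uq_K /uq_KV -!pproj_gen -!pprojM -pprojZ; apply: pproj_rel; exact: uq_KE. Qed.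
Lemma uqKF i j : t i * f j * tV i = q ^ (- A i j) *: f j.
Proof. rewrite /uq_E /uq_F /uq_K /uq_KV -!pproj_gen -!pprojM -pprojZ; apply: pproj_rel; exact: uq_KF. Qed.
Lemma uqEF i j :
  e i * f j - f j * e i = ((i == j)%:R / (q - q^-1)) *: (t i - tV i).
Proof.
rewrite /uq_E /uq_F /uq_K /uq_KV -!pproj_gen -!pprojM -!pprojN -!pprojD -pprojZ; apply: pproj_rel.
exact: uq_EF.
Qed.

Lemma pproj_qserre m x y : pproj (uq_rel q A) (qserre q m x y) =
  \sum_(0 <= k < m.+1) ((-1) ^+ k * qbinom q m k) *:
    (pproj _ x ^+ (m - k) * pproj _ y * pproj _ x ^+ k).
Proof.
rewrite /qserre raddf_sum; apply: eq_bigr => k _ /=.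
by rewrite pprojZ !pprojM !rmorphXn.
Qed.

Lemma uqserreE i j : i != j ->
  \sum_(0 <= k < `|1 - A i j|.+1) ((-1) ^+ k * qbinom q `|1 - A i j| k) *:
    (e i ^+ (`|1 - A i j| - k) * e j * e i ^+ k) = 0.
Proof.
move=> ne; rewrite /uq_E /uq_F /uq_K /uq_KV -!pproj_gen -pproj_qserre -(pproj0 (uq_rel q A)).
apply: pproj_rel; exact: uq_serreE.
Qed.

Lemma uqserreF i j : i != j ->
  \sum_(0 <= k < `|1 - A i j|.+1) ((-1) ^+ k * qbinom q `|1 - A i j| k) *:
    (f i ^+ (`|1 - A i j| - k) * f j * f i ^+ k) = 0.
Proof.
move=> ne; rewrite /uq_E /uq_F /uq_K /uq_KV -!pproj_gen -pproj_qserre -(pproj0 (uq_rel q A)).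
apply: pproj_rel; exact: uq_serreF.
Qed.

End UqRelations.

Section Cartan.
Variable n : nat.

Lemma cartan_sl_so i j :
  cartan (@rootD n) (fst_ord i) (fst_ord j) = cartan (@rootA n) i j.
Proof. by apply: eq_bigr => k _; rewrite /rootD !snd_ord_subproof. Qed.

Lemma fst_ord_inj : injective (@fst_ord n).
Proof. by move=> i j /(congr1 val) /= /val_inj. Qed.

Lemma snd_ord_inj : injective (@snd_ord n).
Proof. by move=> i j /(congr1 val) /= [] /val_inj. Qed.

End Cartan.

Section LiftUq.
Variables (F : fieldType) (q : F) (r : nat) (A : 'I_r -> 'I_r -> int).
Variables (B : algType F) (relB : B -> B -> Prop).
Variable g : uqgen r -> presAlg relB.

Let e i := g (GenE i).
Let f i := g (GenF i).
Let t i := g (GenK i).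
Let tV i := g (GenKV i).

Hypothesis KK : forall i, t i * tV i = 1.
Hypothesis KVK : forall i, tV i * t i = 1.
Hypothesis KC : forall i j, t i * t j = t j * t i.
Hypothesis KE : forall i j, t i * e j * tV i = q ^ A i j *: e j.
Hypothesis KF : forall i j, t i * f j * tV i = q ^ (- A i j) *: f j.
Hypothesis EF : forall i j,
  e i * f j - f j * e i = ((i == j)%:R / (q - q^-1)) *: (t i - tV i).
Hypothesis SE : forall i j, i != j ->
  \sum_(0 <= k < `|1 - A i j|.+1) ((-1) ^+ k * qbinom q `|1 - A i j| k) *:
    (e i ^+ (`|1 - A i j| - k) * e j * e i ^+ k) = 0.
Hypothesis SF : forall i j, i != j ->
  \sum_(0 <= k < `|1 - A i j|.+1) ((-1) ^+ k * qbinom q `|1 - A i j| k) *: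
    (f i ^+ (`|1 - A i j| - k) * f j * f i ^+ k) = 0.

Lemma feval_qserre m x y : feval g (qserre q m x y) =
  \sum_(0 <= k < m.+1) ((-1) ^+ k * qbinom q m k) *:
    (feval g x ^+ (m - k) * feval g y * feval g x ^+ k).
Proof.
rewrite /qserre raddf_sum; apply: eq_bigr => k _ /=.
by rewrite fevalZ !fevalM !rmorphXn.
Qed.

Lemma uq_feval l s : uq_rel q A l s -> feval g l = feval g s.
Proof.
case=> [i|i|i j|i j|i j|i j|i j ne|i j ne].
- rewrite [LHS]fevalM feval1 !feval_gen; exact: KK.
- rewrite [LHS]fevalM feval1 !feval_gen; exact: KVK.
- rewrite [LHS]fevalM [RHS]fevalM !feval_gen; exact: KC.
- rewrite [LHS]fevalM fevalM fevalZ !feval_gen; exact: KE.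
- rewrite [LHS]fevalM fevalM fevalZ !feval_gen; exact: KF.
- rewrite [LHS]fevalD fevalN [X in X - _]fevalM [X in _ - X]fevalM.
  rewrite fevalZ fevalD fevalN !feval_gen; exact: EF.
- rewrite feval_qserre !feval_gen feval0; exact: SE.
- rewrite feval_qserre !feval_gen feval0; exact: SF.
Qed.

End LiftUq.

Section SlSo.
Variables (F : fieldType) (q : F) (n : nat).

Lemma sl_so_feval l s : uq_rel q (cartan (@rootA n)) l s ->
  feval (@sl_so_gen F q n) l = feval (@sl_so_gen F q n) s.
Proof.
apply: uq_feval => [i|i|i j|i j|i j|i j|i j ne|i j ne] /=.
- exact: uqKK.
- exact: uqKVK.
- exact: uqKC.
- by rewrite uqKE cartan_sl_so.
- by rewrite uqKF cartan_sl_so.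
- by rewrite uqEF (inj_eq (@fst_ord_inj n)).
- by rewrite -cartan_sl_so uqserreE // (inj_eq (@fst_ord_inj n)).
- by rewrite -cartan_sl_so uqserreF // (inj_eq (@fst_ord_inj n)).
Qed.

Lemma sl_so_morphism : alg_morphism (@sl_so F q n).
Proof. exact: plift_morphism sl_so_feval. Qed.

Lemma sl_so_E i : sl_so (uq_E q _ i) = uq_E q (cartan (@rootD n)) (fst_ord i).
Proof. exact: plift_gen sl_so_feval _. Qed.
Lemma sl_so_F i : sl_so (uq_F q _ i) = uq_F q (cartan (@rootD n)) (fst_ord i).
Proof. exact: plift_gen sl_so_feval _. Qed.
Lemma sl_so_K i : sl_so (uq_K q _ i) = uq_K q (cartan (@rootD n)) (fst_ord i).
Proof. exact: plift_gen sl_so_feval _. Qed.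
Lemma sl_so_KV i :
  sl_so (uq_KV q _ i) = uq_KV q (cartan (@rootD n)) (fst_ord i).
Proof. exact: plift_gen sl_so_feval _. Qed.

End SlSo.

Lemma qbinom1 (F : fieldType) (q : F) : qbinom q 1 1 = qbinom q 1 0.
Proof. by rewrite /qbinom mulrC [_ * qfact _ _]mulrC mulrC. Qed.

Section Serre.
Variables (F : fieldType) (B : algType F) (relB : B -> B -> Prop) (q : F).
Variables x y : presAlg relB.

Let serre m := \sum_(0 <= k < m.+1)
  ((-1) ^+ k * qbinom q m k) *: (x ^+ (m - k) * y * x ^+ k).

Lemma serre_comm : x * y = y * x -> serre 1 = 0.
Proof.
move=> xy; rewrite /serre !big_nat_recl // big_geq // addr0 /=.
rewrite subn0 subnn !expr1 !expr0 mulr1 !mul1r xy qbinom1.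
by rewrite mulN1r scaleNr subrr.
Qed.

Lemma serre_nil : x * x = 0 -> x * y * x = 0 -> serre 2 = 0.
Proof.
move=> xx xyx; rewrite /serre !big_nat_recl // big_geq // addr0 /=.
rewrite subn0 subnn !expr1 expr0 mulr1 mul1r !expr2 xx xyx.
by rewrite mul0r mulr0 !scaler0 !addr0.
Qed.

End Serre.

Lemma zmod_phi (V : zmodType) (y1 y2 y3 z2 z3 z4 : V) :
  - (y1 - z2 - (y3 - z4)) + (y1 - z3 - (y2 - z4)) = y3 - z3 - (y2 - z2).
Proof.
rewrite !opprB [LHS](AC ((2*2)*(2*2)) ((1*6)*(3*8)*(2*7)*(4*5))) /=.
by rewrite !addNr !addr0.
Qed.

Section CliffordTheory.
Variables (F : fieldType) (q : F) (n : nat).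
Hypotheses (q_neq0 : q != 0) (two_neq0 : 2%:R != 0 :> F).

Local Notation p := (@cl_psi F q n).
Local Notation d := (@cl_psiD F q n).
Local Notation w := (@cl_om F q n).
Local Notation v := (@cl_omV F q n).
Local Notation c := (q - q^-1)^-1.

Lemma omK a : w a * v a = 1.
Proof.
rewrite /cl_om /cl_omV -!pproj_gen -!pprojM; apply: pproj_rel; exact: cl_omK.
Qed.
Lemma omVK a : v a * w a = 1.
Proof.
rewrite /cl_om /cl_omV -!pproj_gen -!pprojM; apply: pproj_rel; exact: cl_omVK.
Qed.
Lemma omC a b : w a * w b = w b * w a.
Proof. rewrite /cl_om -!pproj_gen -!pprojM; apply: pproj_rel; exact: cl_omC. Qed.

Lemma om_psi a b : w a * p b * v a = q ^+ (a == b) *: p b.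
Proof.
rewrite /cl_om /cl_omV /cl_psi -!pproj_gen -!pprojM -pprojZ.
apply: pproj_rel; exact: cl_om_psi.
Qed.
Lemma om_psiD a b : w a * d b * v a = q ^- (a == b) *: d b.
Proof.
rewrite /cl_om /cl_omV /cl_psiD -!pproj_gen -!pprojM -pprojZ.
apply: pproj_rel; exact: cl_om_psiD.
Qed.
Lemma psi_psi a b : p a * p b = - (p b * p a).
Proof.
apply/eqP; rewrite -addr_eq0 /cl_psi -!pproj_gen -!pprojM -pprojD; apply/eqP.
by rewrite -(pproj0 (@cl_rel F q n)); apply: pproj_rel; exact: cl_psi_psi.
Qed.
Lemma psiD_psiD a b : d a * d b = - (d b * d a).
Proof.
apply/eqP; rewrite -addr_eq0 /cl_psiD -!pproj_gen -!pprojM -pprojD; apply/eqP.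
by rewrite -(pproj0 (@cl_rel F q n)); apply: pproj_rel; exact: cl_psiD_psiD.
Qed.
Lemma psi_psiD a b : a != b -> p a * d b = - (d b * p a).
Proof.
move=> ne; apply/eqP; rewrite -addr_eq0 /cl_psi /cl_psiD -!pproj_gen -!pprojM.
rewrite -pprojD; apply/eqP.
by rewrite -(pproj0 (@cl_rel F q n)); apply: pproj_rel; exact: cl_psi_psiD.
Qed.
Lemma psiD_psi a b : a != b -> d a * p b = - (p b * d a).
Proof. by rewrite eq_sym => /psi_psiD ->; rewrite opprK. Qed.
Lemma psi_psiDK a : p a * d a = c *: (q *: w a - q^-1 *: v a).
Proof.
rewrite /cl_psi /cl_psiD /cl_om /cl_omV -!pproj_gen -!pprojM -!pprojZ.
by rewrite -pprojN -pprojD -pprojZ; apply: pproj_rel; exact: cl_psi_psiDK.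
Qed.
Lemma psiD_psiK a : d a * p a = - (c *: (w a - v a)).
Proof.
rewrite /cl_psi /cl_psiD /cl_om /cl_omV -!pproj_gen -!pprojM -!pprojN -!pprojD.
by rewrite -pprojZ -pprojN; apply: pproj_rel; exact: cl_psiD_psiK.
Qed.

Lemma anti_sq0 (x : Clq q n) : x * x = - (x * x) -> x * x = 0.
Proof.
move/eqP; rewrite -addr_eq0 -mulr2n -scaler_nat => /eqP xx.
by rewrite -[LHS]scale1r -(mulVf two_neq0) -scalerA xx scaler0.
Qed.

Lemma psi_sq a : p a * p a = 0. Proof. exact/anti_sq0/psi_psi. Qed.
Lemma psiD_sq a : d a * d a = 0. Proof. exact/anti_sq0/psiD_psiD. Qed.

Lemma omVC a b : v a * w b = w b * v a.
Proof.
rewrite -[LHS]mulr1 -(omK a) mulrA -[v a * _ * _]mulrA -omC.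
by rewrite [v a * _]mulrA omVK mul1r.
Qed.
Lemma omVVC a b : v a * v b = v b * v a.
Proof.
rewrite -[LHS]mulr1 -(omK a) mulrA -[v a * _ * _]mulrA omVC.
by rewrite [v a * _]mulrA omVK mul1r.
Qed.

Definition weight (mu : 'I_n -> int) (x : Clq q n) :=
  forall a, w a * x * v a = q ^ mu a *: x.

Lemma weightM mu nu x y : weight mu x -> weight nu y ->
  weight (fun a => mu a + nu a) (x * y).
Proof.
move=> wx wy a; rewrite expfzDr // -scalerA presAr presAl -wx -wy.
by rewrite !mulrA -(mulrA _ (v a)) omVK mulr1.
Qed.

Lemma weight_psi b : weight (fun a => (a == b)%:R) (p b).
Proof. by move=> a; rewrite om_psi; case: eqP => _; rewrite ?expr1z. Qed.

Lemma weight_psiD b : weight (fun a => - (a == b)%:R) (d b).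
Proof.
move=> a; rewrite om_psiD; case: eqP => _ /=.
  by rewrite exprN1 expr1.
by rewrite oppr0 expr0z expr0 invr1.
Qed.

Lemma weightV mu x a : weight mu x -> v a * x * w a = q ^ (- mu a) *: x.
Proof.
move=> wx; have {1}-> : x = q ^ (- mu a) *: (w a * x * v a).
  by rewrite wx scalerA -expfzDr // addNr expr0z scale1r.
by rewrite -presAr -presAl !mulrA omVK mul1r -mulrA omVK mulr1.
Qed.

Lemma anti_kill (x y1 y2 y3 : Clq q n) : x * x = 0 ->
  x * y1 = - (y1 * x) -> x * y2 = - (y2 * x) -> x * y3 = - (y3 * x) ->
  x * y1 * y2 * y3 * x = 0.
Proof.
move=> xx e1 e2 e3; rewrite e1 !mulNr -(mulrA y1) e2 mulrN !mulNr opprK.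
by rewrite -!mulrA (mulrA x) e3 mulNr -mulrA xx mulr0 oppr0 !mulr0.
Qed.

Lemma anti_comm (x1 x2 y1 y2 : Clq q n) :
  x1 * y1 = - (y1 * x1) -> x1 * y2 = - (y2 * x1) ->
  x2 * y1 = - (y1 * x2) -> x2 * y2 = - (y2 * x2) ->
  (x1 * x2) * (y1 * y2) = (y1 * y2) * (x1 * x2).
Proof.
move=> e11 e12 e21 e22; rewrite -mulrA (mulrA x2) e21 mulNr mulrN.
rewrite -(mulrA y1 x2) e22 !mulrN opprK !mulrA e11 !mulNr -(mulrA y1 x1) e12.
by rewrite mulrN !mulNr opprK !mulrA.
Qed.

End CliffordTheory.

Section PhiMorphism.
Variables (F : fieldType) (q : F) (n : nat).
Hypotheses (q_neq0 : q != 0) (two_neq0 : 2%:R != 0 :> F).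

Local Notation p := (@cl_psi F q n).
Local Notation d := (@cl_psiD F q n).
Local Notation w := (@cl_om F q n).
Local Notation v := (@cl_omV F q n).
Local Notation c := (q - q^-1)^-1.
Local Notation fo := (@fst_ord n).
Local Notation so := (@snd_ord n).

Lemma fst_snd i : fo i != so i.
Proof. by rewrite -val_eqE /= neq_ltn leqnn. Qed.

Lemma sum_rootA i (g : 'I_n -> int) :
  \sum_k rootA i k * g k = g (fo i) - g (so i).
Proof.
have sE a : \sum_(k < n) (k == a)%:R * g k = g a.
  rewrite (bigD1 a) //= eqxx mul1r big1 ?addr0 // => k /negPf ->.
  by rewrite mul0r.
by rewrite /rootA -!sE -sumrB; apply: eq_bigr => k _; rewrite mulrBl.
Qed.

Lemma Phi_conj i mu (x : Clq q n) : weight mu x ->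
  v (fo i) * w (so i) * x * (w (fo i) * v (so i)) =
  q ^ (- \sum_k rootA i k * mu k) *: x.
Proof.
move=> wx; rewrite -(omVC q (so i) (fo i)) !mulrA -(mulrA (v _)) -(mulrA (v _)).
rewrite wx -presAr -presAl (weightV q_neq0 _ wx) scalerA -expfzDr //.
by rewrite sum_rootA opprB.
Qed.

Lemma weight_Phi_E j :
  weight (fun k => - rootA j k) (d (fo j) * p (so j)).
Proof.
move=> a; have /(_ a) := weightM q_neq0 (weight_psiD q (fo j)) (weight_psi q (so j)).
by rewrite /rootA opprB addrC.
Qed.

Lemma weight_Phi_F j : weight (rootA j) (d (so j) * p (fo j)).
Proof.
move=> a; have /(_ a) := weightM q_neq0 (weight_psiD q (so j)) (weight_psi q (fo j)).
by rewrite /rootA addrC.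
Qed.

Lemma Phi_EF_diag a b : a != b ->
  d a * p b * (d b * p a) - d b * p a * (d a * p b) =
  c *: (v a * w b - w a * v b).
Proof.
move=> ne; have ne' : b != a by rewrite eq_sym.
have -> : d a * p b * (d b * p a) = d a * p a * (p b * d b).
  rewrite -!mulrA; congr (_ * _).
  by rewrite (psiD_psi q ne') mulrN !mulrA (psi_psi q b a) !mulNr opprK.
have -> : d b * p a * (d a * p b) = d b * p b * (p a * d a).
  rewrite -!mulrA; congr (_ * _).
  by rewrite (psiD_psi q ne) mulrN !mulrA (psi_psi q a b) !mulNr opprK.
rewrite !psiD_psiK !psi_psiDK !mulNr opprK.
rewrite -!presAl -!presAr.
have cc (x y : Clq q n) :
    - (c *: (c *: x)) + c *: (c *: y) = c *: (c *: (- x + y)).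
  by rewrite !scalerDr !scalerN.
rewrite cc.
have e (x y : 'I_n) : (w x - v x) * (q *: w y - q^-1 *: v y) =
    q *: (w x * w y) - q^-1 *: (w x * v y) -
    (q *: (v x * w y) - q^-1 *: (v x * v y)).
  by rewrite mulrBl !mulrBr -!presAr.
rewrite !e (omC q b a) -(omVC q a b) (omVC q b a) (omVVC q b a).
rewrite zmod_phi -!scalerBl -scalerBr.
have [q1|q1] := eqVneq (q - q^-1) 0; first by rewrite q1 invr0 !scale0r.
by rewrite (scalerA c (q - q^-1)) mulVf // scale1r.
Qed.

Lemma cartanAE i j : cartan (@rootA n) i j =
  (fo i == fo j)%:R - (fo i == so j)%:R - ((so i == fo j)%:R - (so i == so j)%:R).
Proof. by rewrite /cartan sum_rootA. Qed.

Lemma cartanA_adj i j : (fo i == so j) || (so i == fo j) ->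
  cartan (@rootA n) i j = -1.
Proof.
rewrite cartanAE -!val_eqE /= eqSS => /orP[] /eqP e.
  by rewrite e eqxx !gtn_eqF // ltnS.
by rewrite -e eqxx !ltn_eqF // ltnS.
Qed.

Lemma cartanA_far i j : i != j -> (fo i != so j) && (so i != fo j) ->
  cartan (@rootA n) i j = 0.
Proof.
move=> ne /andP[/negPf n1 /negPf n2]; rewrite cartanAE n1 n2.
by rewrite (inj_eq (@fst_ord_inj n)) (inj_eq (@snd_ord_inj n)) (negPf ne).
Qed.

Lemma pair_sq a b : a != b -> d a * p b * (d a * p b) = 0.
Proof.
move=> ne; rewrite -mulrA (mulrA (p b)) psi_psiD 1?eq_sym // mulNr mulrN.
by rewrite !mulrA psiD_sq // !mul0r oppr0.
Qed.

Lemma pair_sandwich a b a' b' : a != b -> (a != b') || (b != a') ->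
  d a * p b * (d a' * p b') * (d a * p b) = 0.
Proof.
move=> ne /orP[n1|n1]; rewrite !mulrA.
  rewrite (anti_kill (psiD_sq q two_neq0 a)) ?mul0r //.
  - exact: psiD_psi.
  - exact: psiD_psiD.
  exact: psiD_psi.
rewrite -!mulrA; apply: etrans (mulr0 (d a)); congr (_ * _); rewrite !mulrA.
apply: (anti_kill (psi_sq q two_neq0 b)).
- exact: psi_psiD.
- exact: psi_psi.
by apply: psi_psiD; rewrite eq_sym.
Qed.

Lemma pair_comm a b a' b' : a != b' -> b != a' ->
  d a * p b * (d a' * p b') = d a' * p b' * (d a * p b).
Proof.
move=> n1 n2; apply: anti_comm.
- exact: psiD_psiD.
- exact: psiD_psi.
- exact: psi_psiD.
exact: psi_psi.
Qed.

Lemma not_adj2 i j : (fo i != so j) || (so i != fo j).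
Proof.
rewrite -!val_eqE /= -negb_and; apply/andP => -[/eqP -> /eqP e].
by have := ltnW (ltnSn (j : nat).+1); rewrite e ltnn.
Qed.

Lemma Phi_feval l s : uq_rel q (cartan (@rootA n)) l s ->
  feval (@Phi_gen F q n) l = feval (@Phi_gen F q n) s.
Proof.
apply: uq_feval => [i|i|i j|i j|i j|i j|i j ne|i j ne] /=.
- rewrite -(omVC q (so i)) !mulrA -(mulrA (v (fo i))) omK mulr1; exact: omVK.
- rewrite (omVC q (fo i)) !mulrA -(mulrA (w (fo i))) omVK mulr1; exact: omK.
- apply: commrM; apply: commr_sym; apply: commrM.
  + exact: omVVC.
  + exact: omVC.
  + by rewrite /GRing.comm omVC.
  exact: omC.
- by rewrite (Phi_conj i (weight_Phi_E j)) /cartan -sumrN; congr (_ ^ _ *: _);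
    apply: eq_bigr => k _; rewrite mulrN opprK.
- by rewrite (Phi_conj i (weight_Phi_F j)).
- have [->|ne] := eqVneq i j; first by rewrite mul1r Phi_EF_diag ?fst_snd.
  rewrite mul0r scale0r; apply/eqP; rewrite subr_eq0; apply/eqP.
  by apply: pair_comm; rewrite ?(inj_eq (@fst_ord_inj n)) ?(inj_eq (@snd_ord_inj n)).
- have [adj|] := boolP ((fo i == so j) || (so i == fo j)).
    rewrite cartanA_adj //; apply: serre_nil; first exact/pair_sq/fst_snd.
    by apply: pair_sandwich; [exact: fst_snd | exact: not_adj2].
  rewrite negb_or => far; rewrite cartanA_far //; apply: serre_comm.
  by case/andP: far => n1 n2; apply: pair_comm.
have sf k : so k != fo k by rewrite eq_sym fst_snd.
have [adj|] := boolP ((fo i == so j) || (so i == fo j)).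
  rewrite cartanA_adj //; apply: serre_nil; first exact: pair_sq.
  by apply: pair_sandwich; [exact: sf | rewrite orbC; exact: not_adj2].
rewrite negb_or => far; rewrite cartanA_far //; apply: serre_comm.
by case/andP: far => n1 n2; apply: pair_comm.
Qed.

Lemma Phi_morphism : alg_morphism (@Phi F q n).
Proof. exact: plift_morphism Phi_feval. Qed.

Lemma Phi_E i : Phi (uq_E q _ i) = d (fo i) * p (so i).
Proof. exact: plift_gen Phi_feval _. Qed.
Lemma Phi_F i : Phi (uq_F q _ i) = d (so i) * p (fo i).
Proof. exact: plift_gen Phi_feval _. Qed.
Lemma Phi_K i : Phi (uq_K q _ i) = v (fo i) * w (so i).
Proof. exact: plift_gen Phi_feval _. Qed.

End PhiMorphism.

Definition Cq (R : realType) : fieldType := {fraction {poly R[i]}}.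
Definition qX (R : realType) : Cq R := tofrac 'X.

Lemma qX_neq0 (R : realType) : qX R != 0.
Proof. by rewrite tofrac_eq0 polyX_eq0. Qed.

Lemma Cq_two_neq0 (R : realType) : 2%:R != 0 :> Cq R.
Proof.
rewrite -(rmorph_nat (@tofrac {poly R[i]})) tofrac_eq0 -polyC_natr polyC_eq0.
by rewrite Num.Theory.pnatr_eq0.
Qed.

(* Main.v *)
(* Exchanging psi_b with psi_b^dagger and omega_b with (q omega_b)^{-1} at a  *)
(* single site b is an involutive automorphism of Cl_q(n). For b = n it maps  *)
(* the images of E_{n-1}, F_{n-1}, K_{n-1} under Phi to the prescribed images *)
(* of E_n, F_n, K_n, and it fixes the images of the generators with i < n-1.  *)
(* Each relation of U_q(so_2n) involves at most two nodes i, j: it is thus    *)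
(* the image of a relation of U_q(sl_n) under Phi or under Phi followed by    *)
(* the automorphism, unless {i, j} = {n-1, n}, where it is checked directly.  *)

Require Import Defs.
From HB Require Import structures.
From mathcomp Require Import all_boot all_order all_algebra.
From mathcomp Require Import reals complex monalg.

Set Implicit Arguments.
Unset Strict Implicit.
Unset Printing Implicit Defensive.

Import GRing.Theory.
Local Open Scope ring_scope.

(** The reflection sending $e_n$ to $-e_n$ swaps $\alpha_{n-1}$ and $\alpha_n$ and fixes the other
    simple roots. Its counterpart on $Cl_q(n)$ is the particle-hole automorphism [hole] at site $n$,
    so the image of node $n$ is taken to be [hole] of the image of node $n-1$. The relations between
    two nodes are bundled in [uq_pair], which every algebra morphism preserves ([uq_pair_morph]).
    [Phi] thus yields all pairs without node $n$, and [hole] turns the pairs of $n-1$ with $i\ne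
    n-1$, or with itself, into those of $n$ ([hole_fixes_Phi]).

    Only the fork $\{n-1,n\}$ remains ([uq_pair_fork]). Its Cartan entry is 0, so the generators
    must commute. They do because $E_{n-1}$ shares $\psi_{n-1}^\dagger$ with $E_n$ and $\psi_n$ with
    $F_n$, and likewise for $F_{n-1}$: each product contains the square of a letter and is 0. *)

(** * Algebra morphisms between presented algebras *)

Section AlgMorphism.
Variables (F : fieldType) (A B : algType F).
Variables (relA : A -> A -> Prop) (relB : B -> B -> Prop).
Variable phi : presAlg relA -> presAlg relB.
Hypothesis phiP : alg_morphism phi.

Lemma alg_morphD x y : phi (x + y) = phi x + phi y.
Proof. by have := phiP.1 1 x y; rewrite !scale1r. Qed.

Lemma alg_morph0 : phi 0 = 0.
Proof. by apply: (addrI (phi 0)); rewrite -alg_morphD !addr0. Qed.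

Lemma alg_morphZ c x : phi (c *: x) = c *: phi x.
Proof. by have := phiP.1 c x 0; rewrite alg_morph0 !addr0. Qed.

Lemma alg_morphN x : phi (- x) = - phi x.
Proof. by rewrite -scaleN1r alg_morphZ scaleN1r. Qed.

Lemma alg_morphM x y : phi (x * y) = phi x * phi y.
Proof. exact: phiP.2.2. Qed.

Lemma alg_morph1 : phi 1 = 1. Proof. exact: phiP.2.1. Qed.

Lemma alg_morphX x k : phi (x ^+ k) = phi x ^+ k.
Proof. by elim: k => [|k IH]; rewrite ?alg_morph1 // !exprS alg_morphM IH. Qed.

Lemma alg_morph_sum I (r : seq I) (f : I -> presAlg relA) :
  phi (\sum_(i <- r) f i) = \sum_(i <- r) phi (f i).
Proof. exact: (big_morph phi alg_morphD alg_morph0). Qed.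

End AlgMorphism.

Lemma alg_morphism_comp (F : fieldType) (A B C : algType F)
    (relA : A -> A -> Prop) (relB : B -> B -> Prop) (relC : C -> C -> Prop)
    (phi : presAlg relA -> presAlg relB) (psi : presAlg relB -> presAlg relC) :
  alg_morphism phi -> alg_morphism psi -> alg_morphism (psi \o phi).
Proof.
move=> phiP psiP; split=> [c x y|] /=; last split=> [|x y] /=.
- by rewrite phiP.1 psiP.1.
- by rewrite phiP.2.1 psiP.2.1.
by rewrite phiP.2.2 psiP.2.2.
Qed.

Lemma fmono_prod (F : fieldType) (X : choiceType) (c : F) (m : {fmonom X}) :
  fmono c m = c *: \prod_(x <- (m : seq X)) fgen F x.
Proof.
rewrite -[c in LHS]mulr1 -fmonoZ; congr (_ *: _).
case: m => s /=; elim: s => [|x s IH].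
  by rewrite big_nil (_ : FMonom [::] = mone) //; apply: val_inj; rewrite /= fm1.
rewrite big_cons -IH fgen.unlock fmonoM mulr1; congr fmono.
by apply: val_inj; rewrite /= fmM fmU.
Qed.

(** Every element is the class of a linear combination of products of generators. *)
Lemma alg_morphism_ext (F : fieldType) (X : choiceType) (B : algType F)
    (rel : freeAlg F X -> freeAlg F X -> Prop) (relB : B -> B -> Prop)
    (phi psi : presAlg rel -> presAlg relB) :
  alg_morphism phi -> alg_morphism psi ->
  (forall x, phi (pgen rel x) = psi (pgen rel x)) -> phi =1 psi.
Proof.
move=> phiP psiP e y; rewrite -[y]preprK.
elim/freeAlg_ind: (prepr y) => [|c m x IH].
  by rewrite pproj0 (alg_morph0 phiP) (alg_morph0 psiP).
rewrite pprojD (alg_morphD phiP) (alg_morphD psiP) {}IH; congr (_ + _).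
rewrite fmono_prod pprojZ (alg_morphZ phiP) (alg_morphZ psiP); congr (_ *: _).
elim: (m : seq X) => [|z s IH].
  by rewrite big_nil pproj1 (alg_morph1 phiP) (alg_morph1 psiP).
by rewrite big_cons pprojM pproj_gen (alg_morphM phiP) (alg_morphM psiP) e IH.
Qed.

(** * Quantum group relations between two nodes *)

Section UqPair.
Variables (F : fieldType) (q : F).

Definition serre_sum (B : algType F) (relB : B -> B -> Prop) (m : nat)
    (x y : presAlg relB) : presAlg relB :=
  \sum_(0 <= k < m.+1)
    ((-1) ^+ k * qbinom q m k) *: (x ^+ (m - k) * y * x ^+ k).

(** The pair is ordered: the unprimed node acts on the primed one. The Cartan entry [a] and the test
    [eq] are parameters, so that a pair of nodes of $A_{n-1}$ can serve as a pair of nodes of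
    $D_n$. *)
Definition uq_pair (B : algType F) (relB : B -> B -> Prop) (a : int) (eq : bool)
    (e f t tV e' f' t' : presAlg relB) : Prop :=
  [/\ [/\ t * tV = 1, tV * t = 1 & t * t' = t' * t],
      t * e' * tV = q ^ a *: e',
      t * f' * tV = q ^ (- a) *: f',
      e * f' - f' * e = (eq%:R / (q - q^-1)) *: (t - tV)
    & ~~ eq -> serre_sum `|1 - a| e e' = 0 /\ serre_sum `|1 - a| f f' = 0].

Lemma uq_pair_gen (r : nat) (A : 'I_r -> 'I_r -> int) i j :
  uq_pair (A i j) (i == j) (uq_E q A i) (uq_F q A i) (uq_K q A i) (uq_KV q A i)
    (uq_E q A j) (uq_F q A j) (uq_K q A j).
Proof.
split; first by rewrite uqKK uqKVK uqKC.
- exact: uqKE.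
- exact: uqKF.
- exact: uqEF.
by move=> ne; split; [exact: uqserreE | exact: uqserreF].
Qed.

Lemma alg_morph_serre_sum (B C : algType F) (relB : B -> B -> Prop)
    (relC : C -> C -> Prop) (phi : presAlg relB -> presAlg relC) m x y :
  alg_morphism phi -> phi (serre_sum m x y) = serre_sum m (phi x) (phi y).
Proof.
move=> phiP; rewrite (alg_morph_sum phiP); apply: eq_bigr => k _.
by rewrite (alg_morphZ phiP) !(alg_morphM phiP) !(alg_morphX phiP).
Qed.

Lemma uq_pair_morph (B C : algType F) (relB : B -> B -> Prop)
    (relC : C -> C -> Prop) (phi : presAlg relB -> presAlg relC)
    a b e f t tV e' f' t' :
  alg_morphism phi -> uq_pair a b e f t tV e' f' t' ->
  uq_pair a b (phi e) (phi f) (phi t) (phi tV) (phi e') (phi f') (phi t').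
Proof.
move=> phiP [[tK tVK tt'] te tf ef se].
split=> [|||| /se[se1 se2]]; first split.
- by rewrite -(alg_morphM phiP) tK (alg_morph1 phiP).
- by rewrite -(alg_morphM phiP) tVK (alg_morph1 phiP).
- by rewrite -!(alg_morphM phiP) tt'.
- by rewrite -!(alg_morphM phiP) te (alg_morphZ phiP).
- by rewrite -!(alg_morphM phiP) tf (alg_morphZ phiP).
- rewrite -!(alg_morphM phiP) -!(alg_morphN phiP) -!(alg_morphD phiP) ef.
  by rewrite (alg_morphZ phiP).
by rewrite -!(alg_morph_serre_sum _ _ _ phiP) se1 se2 (alg_morph0 phiP).
Qed.

(** Relations that name a single node are read off the diagonal pairs. *)
Lemma uq_feval_pair (B : algType F) (relB : B -> B -> Prop) (r : nat)
    (A : 'I_r -> 'I_r -> int) (g : uqgen r -> presAlg relB) :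
  (forall i j, uq_pair (A i j) (i == j)
    (g (GenE i)) (g (GenF i)) (g (GenK i)) (g (GenKV i))
    (g (GenE j)) (g (GenF j)) (g (GenK j))) ->
  forall l s, uq_rel q A l s -> feval g l = feval g s.
Proof.
move=> gP; apply: uq_feval => [i|i|i j|i j|i j|i j|i j ne|i j ne].
- by case: (gP i i) => -[].
- by case: (gP i i) => -[].
- by case: (gP i j) => -[].
- by case: (gP i j).
- by case: (gP i j).
- by case: (gP i j).
- by case: (gP i j) => _ _ _ _ /(_ ne)[].
by case: (gP i j) => _ _ _ _ /(_ ne)[].
Qed.

End UqPair.

(** * The particle-hole automorphism of the Clifford algebra *)

Section ParticleHole.
Variables (F : fieldType) (q : F) (n : nat) (b : 'I_n).
Hypothesis q_neq0 : q != 0.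

Local Notation p := (@cl_psi F q n).
Local Notation d := (@cl_psiD F q n).
Local Notation w := (@cl_om F q n).
Local Notation v := (@cl_omV F q n).

(** Replacing $\omega_b$ by $(q\omega_b)^{-1}$, with this factor $q$, is what exchanges the formulas
    for $\psi_b\psi_b^\dagger$ and $\psi_b^\dagger\psi_b$. *)
Definition hole_gen (g : clgen n) : Clq q n :=
  match g with
  | Psi a => if a == b then d a else p a
  | PsiD a => if a == b then p a else d a
  | Om a => if a == b then q^-1 *: v a else w a
  | OmV a => if a == b then q *: w a else v a
  end.

Definition hole : Clq q n -> Clq q n := plift hole_gen.

(** At site [b] the scalars $q^{-1}$ and $q$ cancel, leaving conjugation by $\omega_b^{-1}$, which
    negates the weight. *)
Lemma hole_conj a mu (x : Clq q n) : weight mu x ->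
  hole_gen (Om a) * x * hole_gen (OmV a) =
  q ^ (if a == b then - mu a else mu a) *: x.
Proof.
move=> wx /=; case: eqP => _; last exact: wx.
rewrite -presAr -!presAl scalerA mulfV // scale1r.
exact: weightV.
Qed.

Lemma hole_feval l s : cl_rel q l s -> feval hole_gen l = feval hole_gen s.
Proof.
case=> [a|a|a c|a c|a c|a c|a c|a c ne|a|a].
- rewrite [LHS]fevalM feval1 !feval_gen /=; case: eqP => _; last exact: omK.
  by rewrite -presAr -presAl scalerA mulfV // scale1r omVK.
- rewrite [LHS]fevalM feval1 !feval_gen /=; case: eqP => _; last exact: omVK.
  by rewrite -presAr -presAl scalerA mulVf // scale1r omK.
- rewrite [LHS]fevalM [RHS]fevalM !feval_gen /=.
  case: eqP => _; case: eqP => _; rewrite -?presAr -?presAl -?presAr.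
  + by rewrite omVVC.
  + by rewrite omVC.
  + by rewrite omVC.
  exact: omC.
- rewrite [LHS]fevalM fevalM fevalZ !feval_gen.
  rewrite (_ : hole_gen (Psi c) = if c == b then d c else p c) //.
  case: (eqVneq c b) => [->|ne].
    rewrite (hole_conj _ (weight_psiD q b)) opprK.
    by case: (a == b) => //=; rewrite ?expr1z // oppr0.
  rewrite (hole_conj _ (weight_psi q c)).
  have [->|nea] := eqVneq a b; last by case: (a == c); rewrite ?expr1z.
  by rewrite eq_sym (negPf ne) oppr0.
- rewrite [LHS]fevalM fevalM fevalZ !feval_gen.
  rewrite (_ : hole_gen (PsiD c) = if c == b then p c else d c) //.
  case: (eqVneq c b) => [->|ne].
    rewrite (hole_conj _ (weight_psi q b)).
    by case: (a == b) => //=; rewrite ?exprN1 ?expr1 // expr0z expr0 invr1.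
  rewrite (hole_conj _ (weight_psiD q c)) opprK.
  have [->|nea] := eqVneq a b.
    by rewrite eq_sym (negPf ne) expr0z expr0 invr1.
  by case: (a == c); rewrite ?oppr0 ?exprN1 ?expr1 // expr0z expr0 invr1.
- rewrite [LHS]fevalD fevalM [X in _ + X]fevalM feval0 !feval_gen /=.
  apply/eqP; rewrite addr_eq0; apply/eqP.
  case: eqVneq => [->|na]; case: eqVneq => [->|nc].
  + exact: psiD_psiD.
  + by rewrite psiD_psi // eq_sym.
  + by rewrite psi_psiD.
  exact: psi_psi.
- rewrite [LHS]fevalD fevalM [X in _ + X]fevalM feval0 !feval_gen /=.
  apply/eqP; rewrite addr_eq0; apply/eqP.
  case: eqVneq => [->|na]; case: eqVneq => [->|nc].
  + exact: psi_psi.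
  + by rewrite psi_psiD // eq_sym.
  + by rewrite psiD_psi.
  exact: psiD_psiD.
- rewrite [LHS]fevalD fevalM [X in _ + X]fevalM feval0 !feval_gen /=.
  apply/eqP; rewrite addr_eq0; apply/eqP.
  case: (eqVneq a b) ne => [->|na]; case: (eqVneq c b) => [->|nc] ne.
  + by [].
  + exact: psiD_psiD.
  + exact: psi_psi.
  exact: psi_psiD.
- rewrite [LHS]fevalM fevalZ fevalD fevalN !fevalZ !feval_gen /=.
  case: eqP => _; last exact: psi_psiDK.
  rewrite psiD_psiK !scalerA mulfV // mulVf // !scale1r.
  by rewrite -(scalerN (q - q^-1)^-1) opprB.
- rewrite [LHS]fevalM fevalN fevalZ fevalD fevalN !feval_gen /=.
  case: eqP => _; last exact: psiD_psiK.
  by rewrite psi_psiDK -(scalerN (q - q^-1)^-1) opprB.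
Qed.

Lemma hole_morphism : alg_morphism hole.
Proof. exact: plift_morphism hole_feval. Qed.

Lemma hole_psi a : hole (p a) = if a == b then d a else p a.
Proof. exact: plift_gen hole_feval _. Qed.
Lemma hole_psiD a : hole (d a) = if a == b then p a else d a.
Proof. exact: plift_gen hole_feval _. Qed.
Lemma hole_om a : hole (w a) = if a == b then q^-1 *: v a else w a.
Proof. exact: plift_gen hole_feval _. Qed.
Lemma hole_omV a : hole (v a) = if a == b then q *: w a else v a.
Proof. exact: plift_gen hole_feval _. Qed.

(** It allows the fork to be checked in one order only: [hole] exchanges its two nodes. *)
Lemma hole_involutive : involutive hole.
Proof.
have hM := hole_morphism.
apply: (alg_morphism_ext (alg_morphism_comp hM hM)) => [|g /=]; first by split.
have hZ := alg_morphZ hM.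
case: g => a; rewrite -/(p a) -/(d a) -/(w a) -/(v a).
- by rewrite hole_psi; case: eqP => [->|/eqP/negPf e];
    rewrite ?hole_psiD ?hole_psi ?eqxx ?e.
- by rewrite hole_psiD; case: eqP => [->|/eqP/negPf e];
    rewrite ?hole_psiD ?hole_psi ?eqxx ?e.
- rewrite hole_om; case: eqP => [->|/eqP/negPf e]; last by rewrite hole_om e.
  by rewrite hZ hole_omV eqxx scalerA mulVf // scale1r.
rewrite hole_omV; case: eqP => [->|/eqP/negPf e]; last by rewrite hole_omV e.
by rewrite hZ hole_om eqxx scalerA mulfV // scale1r.
Qed.

End ParticleHole.

(** * Construction of the map on $U_q(\mathfrak{so}_{2n})$ *)

Section Phi_so.
Variables (F : fieldType) (q : F) (m : nat).
Hypotheses (q_neq0 : q != 0) (two_neq0 : 2%:R != 0 :> F).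

Local Notation n := m.+2.
Local Notation p := (@cl_psi F q n).
Local Notation d := (@cl_psiD F q n).
Local Notation w := (@cl_om F q n).
Local Notation v := (@cl_omV F q n).
Local Notation fo := (@fst_ord n).
Local Notation so := (@snd_ord n).
Local Notation last := (ord_max : 'I_n).
Local Notation last' := (ord_max : 'I_n.-1).
Local Notation theta := (@hole F q n last).

(** The last node is given through [theta] rather than by explicit formulas, so that its relations
    can be transported; [hole_Phi_last] recovers the formulas. *)
Definition Phi_so_gen (g : uqgen n) : Clq q n :=
  let at_node (gen : 'I_n.-1 -> uqgen n.-1) i :=
    if unlift last i is Some j then Phi_gen q (gen j)
    else theta (Phi_gen q (gen last')) in
  match g with
  | GenE i => at_node (@GenE _) i
  | GenF i => at_node (@GenF _) i
  | GenK i => at_node (@GenK _) i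
  | GenKV i => at_node (@GenKV _) i
  end.

Definition Phi_so : Uq_so q n -> Clq q n := plift Phi_so_gen.

Lemma fst_ord_lift i : fo i = lift last i.
Proof. exact/val_inj/esym/lift_max. Qed.

Lemma snd_ord_last : so last' = last.
Proof. exact: val_inj. Qed.

Lemma snd_ord_eq_last i : (so i == last) = (i == last').
Proof. by rewrite -snd_ord_last (inj_eq (@snd_ord_inj n)). Qed.

Lemma fst_ord_neq_last i : (fo i == last) = false.
Proof. by rewrite fst_ord_lift eq_sym; apply/negbTE/neq_lift. Qed.

Lemma rootD_fst i k : rootD (fo i) k = rootA i k.
Proof. by rewrite /rootD snd_ord_subproof. Qed.

(** This is the reflection of $\alpha_{n-1}$ that negates the coordinate along $e_n$. *)
Lemma rootD_last k :
  rootD last k = if k == last then - rootA last' k else rootA last' k.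
Proof.
rewrite /rootD /rootA snd_ord_last ltnn -!val_eqE /= eqSS.
case: (eqVneq (k : nat) m.+1) => [->|_]; first by rewrite gtn_eqF // sub0r opprK add0r.
by rewrite oppr0.
Qed.

Lemma rootA_last0 i : i != last' -> rootA i last = 0.
Proof.
move=> ne; rewrite /rootA eq_sym fst_ord_neq_last eq_sym snd_ord_eq_last.
by rewrite (negPf ne) subrr.
Qed.

Lemma cartanC (r : nat) (alpha : 'I_r -> 'I_n -> int) i j :
  cartan alpha i j = cartan alpha j i.
Proof. by apply: eq_bigr => k _; rewrite mulrC. Qed.

(** The reflection only changes the last coordinate, where $\alpha_i$ vanishes. *)
Lemma cartanD_last_fst i : i != last' ->
  cartan (@rootD n) last (fo i) = cartan (@rootA n) last' i.
Proof.
move=> ne; apply: eq_bigr => k _; rewrite rootD_fst rootD_last.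
by case: eqP => // ->; rewrite (rootA_last0 ne) !mulr0.
Qed.

Lemma cartanD_last_last :
  cartan (@rootD n) last last = cartan (@rootA n) last' last'.
Proof.
by apply: eq_bigr => k _; rewrite rootD_last; case: eqP; rewrite ?mulrNN.
Qed.

(** The coordinates along $e_{n-1}$ and $e_n$ contribute $1-1$. *)
Lemma cartanD_fork : cartan (@rootD n) (fo last') last = 0.
Proof.
rewrite /cartan; under eq_bigr do rewrite rootD_fst.
rewrite sum_rootA !rootD_last fst_ord_neq_last snd_ord_last eqxx /rootA.
by rewrite !snd_ord_last !eqxx [last == _]eq_sym !fst_ord_neq_last.
Qed.

Lemma uq_pair_Phi i j :
  uq_pair q (cartan (@rootA n) i j) (i == j)
    (Phi_gen q (GenE i)) (Phi_gen q (GenF i))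
    (Phi_gen q (GenK i)) (Phi_gen q (GenKV i))
    (Phi_gen q (GenE j)) (Phi_gen q (GenF j)) (Phi_gen q (GenK j)).
Proof.
have := uq_pair_morph (Phi_morphism n q_neq0 two_neq0)
  (uq_pair_gen q (cartan (@rootA n)) i j).
have Phi_KV k : Phi (uq_KV q _ k) = w (fo k) * v (so k).
  exact: plift_gen (Phi_feval q_neq0 two_neq0) _.
by rewrite !Phi_E // !Phi_F // !Phi_K // !Phi_KV.
Qed.

Lemma hole_fixes_Phi (g : uqgen n.-1) :
  match g with GenE i | GenF i | GenK i | GenKV i => i != last' end ->
  theta (Phi_gen q g) = Phi_gen q g.
Proof.
have hM := alg_morphM (hole_morphism last q_neq0).
case: g => i ne /=; rewrite hM ?hole_psi ?hole_psiD ?hole_om ?hole_omV //;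
  by rewrite fst_ord_neq_last snd_ord_eq_last (negPf ne).
Qed.

Lemma hole_Phi_last :
  [/\ theta (Phi_gen q (GenE last')) = d (fo last') * d last,
      theta (Phi_gen q (GenF last')) = p last * p (fo last'),
      theta (Phi_gen q (GenK last')) = q^-1 *: (v (fo last') * v last)
    & theta (Phi_gen q (GenKV last')) = q *: (w (fo last') * w last)].
Proof.
have hM := alg_morphM (hole_morphism last q_neq0).
split; rewrite /= hM ?hole_psi ?hole_psiD ?hole_om ?hole_omV // snd_ord_last;
  by rewrite fst_ord_neq_last eqxx // presAr.
Qed.

(* Every product of an E with an E, or with an F, of the other node of the   *)
(* fork repeats a letter, hence vanishes.                                     *)
Lemma uq_pair_fork :
  uq_pair q 0 false
    (Phi_gen q (GenE last')) (Phi_gen q (GenF last'))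
    (Phi_gen q (GenK last')) (Phi_gen q (GenKV last'))
    (theta (Phi_gen q (GenE last'))) (theta (Phi_gen q (GenF last')))
    (theta (Phi_gen q (GenK last'))).
Proof.
have [-> -> -> _] := hole_Phi_last.
have [[tK tVK _] _ _ _ _] := uq_pair_Phi last' last'.
have ne : fo last' != last by rewrite fst_ord_neq_last.
have ne' : last != fo last' by rewrite eq_sym.
rewrite /= snd_ord_last in tK tVK *; set a := fo last' in ne ne' tK tVK *.
(* Conjugation by $K_{n-1}$ scales by $q$ to the difference of the weights at $n$ and $n-1$. These
   agree on $E_n$ (both $-1$) and on $F_n$ (both 1). *)
have conj0 mu (x : Clq q n) : weight mu x -> mu a = mu last ->
    v a * w last * x * (w a * v last) = x.
  move=> wx e; have := Phi_conj q_neq0 last' wx.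
  by rewrite snd_ord_last sum_rootA snd_ord_last -/a e subrr oppr0 expr0z scale1r.
split=> [|||| _]; first split=> //.
- rewrite -presAr -presAl; congr (_ *: _).
  apply: commrM; apply: commr_sym; apply: commrM.
  + exact: omVVC.
  + exact: omVC.
  + exact: omVVC.
  by rewrite /GRing.comm -omVC.
- rewrite expr0z scale1r.
  apply: (conj0 _ _ (weightM q_neq0 (weight_psiD q _) (weight_psiD q _))).
  by rewrite !eqxx (negPf ne) (negPf ne') addrC.
- rewrite oppr0 expr0z scale1r.
  apply: (conj0 _ _ (weightM q_neq0 (weight_psi q _) (weight_psi q _))).
  by rewrite !eqxx (negPf ne) (negPf ne') addrC.
- rewrite mul0r scale0r.
  have -> : d a * p last * (p last * p a) = 0.
    by rewrite -mulrA (mulrA (p last)) psi_sq // mul0r mulr0.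
  rewrite (psi_psi q last a) mulNr sub0r opprK -mulrA (mulrA (p last)).
  by rewrite (psi_psiD q ne') mulNr -mulrA psi_sq // mulr0 oppr0 mulr0.
(* For Cartan entry 0 the Serre relation is commutation; both products are shown to be 0. *)
split; apply: serre_comm.
  transitivity (0 : Clq q n).
    rewrite -mulrA (mulrA (p last)) (psi_psiD q ne') mulNr mulrN !mulrA.
    by rewrite psiD_sq // !mul0r oppr0.
  by rewrite (psiD_psiD q a) mulNr -mulrA (mulrA (d a)) psiD_sq // mul0r mulr0 oppr0.
transitivity (0 : Clq q n).
  by rewrite (psi_psi q last) mulrN -mulrA (mulrA (p a)) psi_sq // mul0r mulr0 oppr0.
rewrite -mulrA (mulrA (p a)) (psi_psiD q ne) mulNr mulrN.
by rewrite -mulrA psi_sq // !mulr0 oppr0.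
Qed.

Lemma Phi_so_gen_pair i j :
  uq_pair q (cartan (@rootD n) i j) (i == j)
    (Phi_so_gen (GenE i)) (Phi_so_gen (GenF i))
    (Phi_so_gen (GenK i)) (Phi_so_gen (GenKV i))
    (Phi_so_gen (GenE j)) (Phi_so_gen (GenF j)) (Phi_so_gen (GenK j)).
Proof.
have hM := hole_morphism last q_neq0.
have hK := hole_involutive last q_neq0.
case: (unliftP last i) => [i'|] ->; case: (unliftP last j) => [j'|] ->;
  rewrite /= ?unlift_none ?liftK.
- rewrite -!fst_ord_lift cartan_sl_so (inj_eq (@fst_ord_inj n)).
  exact: uq_pair_Phi.
- rewrite [_ == last]eq_sym (negPf (neq_lift _ _)) -fst_ord_lift.
  have [->|ne] := eqVneq i' last'; first by rewrite cartanD_fork; exact: uq_pair_fork.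
  (* [theta] fixes node [i'] and carries [last'] to the last node of $D_n$. *)
  have := uq_pair_morph hM (uq_pair_Phi i' last').
  rewrite (hole_fixes_Phi (g := GenE i')) // (hole_fixes_Phi (g := GenF i')) //.
  rewrite (hole_fixes_Phi (g := GenK i')) // (hole_fixes_Phi (g := GenKV i')) //.
  by rewrite (negPf ne) cartanC -cartanD_last_fst // cartanC.
- rewrite (negPf (neq_lift _ _)) -fst_ord_lift.
  have [->|ne] := eqVneq j' last'.
    (* The reversed fork is the image of the fork under the involution [theta]. *)
    by rewrite cartanC cartanD_fork; have := uq_pair_morph hM uq_pair_fork; rewrite !hK.
  have := uq_pair_morph hM (uq_pair_Phi last' j').
  rewrite (hole_fixes_Phi (g := GenE j')) // (hole_fixes_Phi (g := GenF j')) //.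
  rewrite (hole_fixes_Phi (g := GenK j')) //.
  by rewrite [_ == j']eq_sym (negPf ne) -cartanD_last_fst.
rewrite eqxx cartanD_last_last -[true](eqxx last').
exact: uq_pair_morph hM (uq_pair_Phi _ _).
Qed.

Lemma Phi_so_morphism : alg_morphism Phi_so.
Proof. exact: plift_morphism (uq_feval_pair Phi_so_gen_pair). Qed.

Lemma Phi_so_genE g : Phi_so (pgen _ g) = Phi_so_gen g.
Proof. exact: plift_gen (uq_feval_pair Phi_so_gen_pair) _. Qed.

(** Both sides are algebra morphisms in [X], so generators suffice. *)
Lemma Phi_so_sl_so X : Phi_so (sl_so X) = Phi X.
Proof.
apply: (alg_morphism_ext (phi := Phi_so \o @sl_so F q n)) X.
- exact: alg_morphism_comp (sl_so_morphism q n) Phi_so_morphism.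
- exact: Phi_morphism.
move=> g; rewrite /= /sl_so (plift_gen (@sl_so_feval F q n)).
rewrite /Phi (plift_gen (Phi_feval q_neq0 two_neq0)).
by case: g => i /=; rewrite Phi_so_genE /= fst_ord_lift liftK -?fst_ord_lift.
Qed.

End Phi_so.

Theorem mainTheorem4 (R : realType) (n : nat) (n_ge2 : (2 <= n)%N) :
  exists PhiD : Uq_so (qX R) n -> Clq (qX R) n,
    [/\ alg_morphism PhiD,
        forall X : Uq_sl (qX R) n, PhiD (sl_so X) = Phi X
      & forall a b : 'I_n, a.+2 = n -> b.+1 = n ->
        [/\ PhiD (uq_E _ _ b) = cl_psiD _ a * cl_psiD _ b,
            PhiD (uq_F _ _ b) = cl_psi _ b * cl_psi _ a
          & PhiD (uq_K _ _ b) = (qX R)^-1 *: (cl_omV _ a * cl_omV _ b)]].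
Proof.
(* Writing $n$ as [m.+2] makes ['I_n.-1] inhabited, so that its greatest element can stand for node
   $n-1$. *)
case: n n_ge2 => [|[|m]] // _.
have q0 := qX_neq0 R; have two0 := Cq_two_neq0 R.
exists (@Phi_so (Cq R) (qX R) m); split.
- exact: Phi_so_morphism.
- exact: Phi_so_sl_so.
move=> a b a_eq b_eq.
have {b b_eq}-> : b = ord_max by apply: val_inj; case: b_eq.
have {a a_eq}-> : a = @fst_ord m.+2 ord_max by apply: val_inj; case: a_eq.
rewrite !(Phi_so_genE q0 two0) /= unlift_none.
by have [-> -> -> _] := hole_Phi_last m q0.
Qed.
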